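(* Let $\mathcal{T}$ be a monoid of transformations of $\Omega$. The model $$\mathcal{S}_{\mathcal{T}}:=\langle\mathcal{L}_{\mathcal{T}};\emptyset\rangle\sqcup\langle\mathcal{L}_{>};\mathcal{L}_{<}\rangle=\langle\mathcal{L}_{\mathcal{T}}\cup(\mathcal{L}_{\mathcal{T}}+\mathcal{L}_{>});\ \mathcal{L}_{\mathcal{T}}+\mathcal{L}_{<}\rangle,$$ where $\sqcup$ denotes the reckoning union, is a favour-indifference model without confusion and with indifference to status quo (i.e., $\mathcal{S}_{\mathcal{T}}\in\mathbb{M}$, $\mathcal{S}_{\mathcal{T}}$ is a favour-indifference assessment, and $0\in(\mathcal{S}_{\mathcal{T}})_{\mathrm{acc}}$) if and only if $f<0$ for no gamble $f$ in $\mathcal{L}_{\mathcal{T}}$.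
   Context: Let $\Omega$ be a non-empty set (the possibility space) and let $\mathcal{L}$ be a real linear subspace of the vector space of all real-valued functions (''gambles'') on $\Omega$ with pointwise operations. Write $f\geq g$ if $\inf(f-g)\geq0$, $f>g$ if $f\geq g$ and $f\neq g$, and $f<g$ if $g>f$; put $\mathcal{L}_{>}=\{f\in\mathcal{L}:f>0\}$ and $\mathcal{L}_{<}=\{f\in\mathcal{L}:f<0\}$. For $\mathcal{K},\mathcal{K}'\subseteq\mathcal{L}$: $-\mathcal{K}=\{-f:f\in\mathcal{K}\}$; $\mathcal{K}\pm\mathcal{K}'=\{f\pm g:f\in\mathcal{K},g\in\mathcal{K}'\}$ (empty if either is empty); $\overline{\mathcal{K}}=\{\lambda f:\lambda>0,f\in\mathcal{K}\}$; $\operatorname{posi}\mathcal{K}$ is the set of all linear combinations with strictly positive coefficients of non-empty finite families of elements of $\mathcal{K}$; $\operatorname{span}\mathcal{K}=\operatorname{posi}(\mathcal{K}\cup-\mathcal{K}\cup\{0\})$ is the linear span of $\mathcal{K}$. A cone is a set $\mathcal{K}\subseteq\mathcal{L}$ with $\operatorname{posi}\mathcal{K}=\mathcal{K}$. A monoid of transformations $\mathcal{T}$ is a set of maps $\Omega\to\Omega$ that is a monoid under composition: closed under composition, associative, and with some $T^*\in\mathcal{T}$ satisfying $T^*\circ T=T\circ T^*=T$ for all $T\in\mathcal{T}$. For a gamble $f$ and $T\in\mathcal{T}$, $T^tf=f\circ T$. The set $\mathcal{L}_{\mathcal{T}}=\operatorname{span}\{f-T^tf:f\in\mathcal{L},T\in\mathcal{T}\}$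 is the set of background indifferent gambles; here the set whose span is taken is understood to be a subset of $\mathcal{L}$. An assessment is a pair $\mathcal{A}=\langle\mathcal{A}_{\mathrm{acc}};\mathcal{A}_{\mathrm{rej}}\rangle$ of subsets of $\mathcal{L}$ (accepted and rejected gambles); inclusion, union and intersection of assessments are component-wise, and the intersection of the empty family of assessments is $\langle\mathcal{L};\mathcal{L}\rangle$. Put $\mathcal{A}_{\mathrm{fav}}=\mathcal{A}_{\mathrm{acc}}\cap-\mathcal{A}_{\mathrm{rej}}$ and $\mathcal{A}_{\mathrm{ind}}=\mathcal{A}_{\mathrm{acc}}\cap-\mathcal{A}_{\mathrm{acc}}$. $\mathcal{A}$ is a favour-indifference assessment if $-\mathcal{A}_{\mathrm{rej}}\subseteq\mathcal{A}_{\mathrm{acc}}$ and $\mathcal{A}_{\mathrm{acc}}=\mathcal{A}_{\mathrm{fav}}\cup\mathcal{A}_{\mathrm{ind}}$. A model without confusion is an assessment $\mathcal{M}$ such that $\mathcal{M}_{\mathrm{acc}}\cap\mathcal{M}_{\mathrm{rej}}=\emptyset$, $\mathcal{M}_{\mathrm{acc}}$ is a cone, and $\overline{\mathcal{M}_{\mathrm{rej}}}\cup(\overline{\mathcal{M}_{\mathrm{rej}}}-\mathcal{M}_{\mathrm{acc}})\subseteq\mathcal{M}_{\mathrm{rej}}$; the set of these is $\mathbb{M}$. The reckoning union $\mathcal{A}\sqcup\mathcal{B}$ of two assessments $\mathcal{A},\mathcal{B}$ is the intersection of all $\mathcal{M}\in\mathbb{M}$ with $\mathcal{A}\cup\ma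thcal{B}\subseteq\mathcal{M}$.
   Formalization: The displayed equality of the reckoning union with the explicit formula is asserted only when no gamble f<0 lies in L_T, as it can fail otherwise; the ''if and only if'' is proved for both the reckoning union and the explicit formula without that condition. *)

(* Defs.v *)
From HB Require Import structures.
From mathcomp Require Import all_boot all_order all_algebra.
From mathcomp Require Import all_classical all_reals ereal.
Set Implicit Arguments.
Unset Strict Implicit.
Unset Printing Implicit Defensive.
Import Order.TTheory GRing.Theory Num.Theory.
Local Open Scope classical_set_scope.
Local Open Scope ring_scope.

Section Cones.
Variables (R : realType) (V : lmodType R).
Definition set_opp (K : set V) : set V := [set - f | f in K].
Definition set_add (K K' : set V) : set V := [set f + g | f in K & g in K'].
Definition set_sub (K K' : set V) : set V := [set f - g | f in K & g in K'].

Definition scaling (K : set V) : set V :=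
  [set l *: f | l in [set l : R | 0 < l] & f in K].

Definition posi (K : set V) : set V :=
  [set f | exists n (c : 'I_n.+1 -> R) (g : 'I_n.+1 -> V),
     [/\ forall i, 0 < c i, forall i, K (g i)
       & f = \sum_(i < n.+1) c i *: g i]].

Definition linspan (K : set V) : set V := posi (K `|` set_opp K `|` [set 0]).

Definition cone (K : set V) : Prop := posi K = K.

End Cones.

Section Assessments.
Variables (R : realType) (V : lmodType R).

Record assessment := Assessment { acc : set V ; rej : set V }.

Implicit Types A B M : assessment.

Definition assessment_on (L : set V) A : Prop :=
  acc A `<=` L /\ rej A `<=` L.

Definition asub A B : Prop := acc A `<=` acc B /\ rej A `<=` rej B.

Definition aunion A B : assessment :=
  Assessment (acc A `|` acc B) (rej A `|` rej B).

(* The explicit [L `&` _] makes the intersection of the empty family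
   [Assessment L L]; it is redundant for non-empty families on [L]. *)
Definition ainter (L : set V) (F : set assessment) : assessment :=
  Assessment (L `&` \bigcap_(M in F) acc M) (L `&` \bigcap_(M in F) rej M).

Definition fav A : set V := acc A `&` set_opp (rej A).
Definition ind A : set V := acc A `&` set_opp (acc A).

Definition favour_indifference A : Prop :=
  set_opp (rej A) `<=` acc A /\ acc A = fav A `|` ind A.

Definition model_without_confusion (L : set V) : set assessment :=
  [set M | [/\ assessment_on L M,
               acc M `&` rej M = set0,
               cone (acc M)
             & scaling (rej M) `|` set_sub (scaling (rej M)) (acc M)
                 `<=` rej M]].

Definition reckoning_union (L : set V) A B : assessment :=
  ainter L [set M | model_without_confusion L M /\ asub (aunion A B) M].

Definition indifferent_to_status_quo A : Prop := acc A 0.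

End Assessments.

Section Gambles.
Variables (R : realType) (Omega : Type).

(* [R^o] is the line [R] as a vector space over itself, which gives the
   pointwise vector space structure on gambles. *)
Definition gamble := Omega -> R^o.
HB.instance Definition _ := GRing.Lmodule.on gamble.

Implicit Types (f g : gamble) (L : set gamble) (TT : set (Omega -> Omega)).

(* The infimum is taken in the extended reals, as gambles may be unbounded
   (the real-valued [inf] is 0 on sets without a lower bound). *)
Definition gge f g : Prop :=
  (0 <= ereal_inf (range (fun w => ((f - g) w)%:E)))%E.
Definition ggt f g : Prop := gge f g /\ f <> g.
Definition glt f g : Prop := ggt g f.

Definition gpos L : set gamble := [set f | L f /\ ggt f 0].
Definition gneg L : set gamble := [set f | L f /\ glt f 0].

Definition linear_subspace L : Prop := submod_closed [in L].

Record transformation_monoid TT : Prop := {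
  tm_comp : forall S T, TT S -> TT T -> TT (S \o T) ;
  tm_assoc : forall S T U, TT S -> TT T -> TT U ->
    S \o (T \o U) = (S \o T) \o U ;
  tm_unit : exists2 Tid, TT Tid &
    forall T, TT T -> Tid \o T = T /\ T \o Tid = T }.

Definition transform (T : Omega -> Omega) f : gamble := f \o T.

(* Differences that fall outside [L] are discarded; if [L] contains all of
   them, nothing is (see [transform_diffsE]). *)
Definition transform_diffs L TT : set gamble :=
  L `&` [set f - transform T f | f in L & T in TT].

Definition background_indifferent L TT : set gamble :=
  linspan (transform_diffs L TT).

Lemma transform_diffsE L TT :
  [set f - transform T f | f in L & T in TT] `<=` L ->
  transform_diffs L TT = [set f - transform T f | f in L & T in TT].
Proof. by move=> sL; apply/setIidPr. Qed.

Definition status_quo_model L TT : assessment gamble :=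
  reckoning_union L (Assessment (background_indifferent L TT) set0)
                    (Assessment (gpos L) (gneg L)).

(* This need not equal [status_quo_model L TT] when some [f] in [LT] is
   [< 0]: no model without confusion is then available, so that
   [status_quo_model L TT] is [Assessment L L].  For instance, with
   [Omega = {a, b}], [TT = {id, cst a}] and [L] everything,
   [LT = [set f | f a = 0]] and all gambles accepted below satisfy
   [0 <= f a]. *)
Definition status_quo_model_explicit L TT : assessment gamble :=
  let LT := background_indifferent L TT in
  Assessment (LT `|` set_add LT (gpos L)) (set_add LT (gneg L)).

Definition status_quo_fi_model L (S : assessment gamble) : Prop :=
  [/\ model_without_confusion L S, favour_indifference S
    & indifferent_to_status_quo S].

End Gambles.

(* Main.v *)
Require Import Defs.
From mathcomp Require Import all_boot all_order all_algebra.
From mathcomp Require Import all_classical all_reals ereal.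
Local Open Scope classical_set_scope.
Local Open Scope ring_scope.

Import Order.TTheory GRing.Theory Num.Theory.

(** The order on gambles enters only through the facts that [gpos L] is closed
    under sums and positive multiples and that [gneg L] is its opposite, so
    the argument is carried out in an arbitrary real vector space: [N] is a
    subspace of the subspace [L], [P] is a part of [L] closed under sums and
    positive multiples, and [quotient_model N P] is the assessment that
    accepts [N] and [N + P] and rejects [N - P].

    If an element is both accepted and rejected there, subtracting the [N]-parts
    produces an element of [N] whose opposite is in [P]; all the other
    requirements are closure computations.  Hence [quotient_model N P] is a
    model exactly when [N] does not meet [- P] ([quotient_model_fiP]; in the
    converse direction, an element of [N] and [- P] is accepted, and rejected
    as the sum of [0] and itself).

    The assessment [quotient_model N P] is contained in every model that
    extends both the assessment accepting [N] and rejecting nothing and the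
    assessment accepting [P] and rejecting [- P] ([quotient_model_min]):
    accepted elements are closed under sums, and [h - p] is a rejected element
    [- p] minus an accepted element [- h].  So, when it is itself a model, it is
    the least one, that is, the reckoning union.  When [N] meets [- P], a common
    element is accepted and rejected in all these models, hence also in their
    intersection, which thus has confusion ([reckoning_union_fiP]). *)

Section VectorSpaces.
Set Implicit Arguments.
Unset Strict Implicit.
Unset Printing Implicit Defensive.
Variables (R : realType) (V : lmodType R).
Implicit Types (K L N P : set V) (M : assessment V).

(** * Positive hulls, cones and spans *)

(** Closure under sums and under multiplication by positive scalars; this
    characterizes cones, see [coneP]. *)
Definition cone_closed K : Prop :=
  (forall f g, K f -> K g -> K (f + g)) /\
  (forall (l : R) f, 0 < l -> K f -> K (l *: f)).

Lemma posi_sub K K' : cone_closed K' -> K `<=` K' -> posi K `<=` K'.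
Proof.
move=> [addK scaleK] sKK' _ [n [c [g [c_gt0 Kg ->]]]].
elim: n c g c_gt0 Kg => [|n IHn] c g c_gt0 Kg.
  by rewrite big_ord1; apply: scaleK => //; apply: sKK'.
rewrite big_ord_recl; apply: addK; first by apply: scaleK => //; apply: sKK'.
by apply: (IHn (fun i => c (lift ord0 i)) (fun i => g (lift ord0 i))).
Qed.

Lemma sub_posi K : K `<=` posi K.
Proof.
move=> f Kf; exists 0, (fun=> 1), (fun=> f); split=> //.
by rewrite big_ord1 scale1r.
Qed.

Lemma posi_closed K : cone_closed (posi K).
Proof.
split=> [_ _ [n [c [f [c_gt0 Kf ->]]]] [m [d [g [d_gt0 Kg ->]]]]|].
  exists (n + m.+1)%N,
    (fun i : 'I_(n.+1 + m.+1) =>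
       match fintype.split i with inl j => c j | inr j => d j end),
    (fun i : 'I_(n.+1 + m.+1) =>
       match fintype.split i with inl j => f j | inr j => g j end).
  split=> [i|i|]; [by case: fintype.split|by case: fintype.split|].
  rewrite (@big_split_ord _ _ _ n.+1 m.+1) /=.
  congr (_ + _); apply: eq_bigr => i _.
    by rewrite -[lshift _ _]/(unsplit (inl i)) unsplitK.
  by rewrite -[rshift _ _]/(unsplit (inr i)) unsplitK.
move=> l _ l_gt0 [n [c [f [c_gt0 Kf ->]]]].
exists n, (fun i => l * c i), f; split=> // [i|]; first exact: mulr_gt0.
by rewrite scaler_sumr; apply: eq_bigr => i _; rewrite scalerA.
Qed.

Lemma coneP K : cone K <-> cone_closed K.
Proof.
split=> [<-|clK]; first exact: posi_closed.
by apply/seteqP; split; [exact: posi_sub|exact: sub_posi].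
Qed.

Lemma set_oppE K f : set_opp K f <-> K (- f).
Proof.
split=> [[g Kg <-]|Kf]; first by rewrite opprK.
by exists (- f); rewrite ?opprK.
Qed.

Section Subspace.
Variable N : set V.
Hypothesis subN : submod_closed [in N].

Lemma subspace0 : N 0.
Proof. by have [/set_mem] := subN. Qed.

Lemma subspaceZD (a : R) f g : N f -> N g -> N (a *: f + g).
Proof.
have [_ lin] := subN => Nf Ng; apply/set_mem/lin; exact: mem_set.
Qed.

Lemma subspaceD f g : N f -> N g -> N (f + g).
Proof. by rewrite -{2}[f]scale1r; exact: subspaceZD. Qed.

Lemma subspaceZ (a : R) f : N f -> N (a *: f).
Proof.
by move=> Nf; rewrite -[_ *: _]addr0; apply: subspaceZD => //; exact: subspace0.
Qed.

Lemma subspaceN f : N f -> N (- f).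
Proof. by rewrite -scaleN1r; exact: subspaceZ. Qed.

Lemma subspaceB f g : N f -> N g -> N (f - g).
Proof. by move=> Nf /subspaceN; exact: subspaceD. Qed.

Lemma linspan_sub K : K `<=` N -> linspan K `<=` N.
Proof.
move=> sKN; apply: posi_sub => [|f [[/sKN//|/set_oppE/sKN]|->]].
- by split=> [f g|l f _]; [exact: subspaceD|exact: subspaceZ].
- by move/subspaceN; rewrite opprK.
- exact: subspace0.
Qed.

End Subspace.

Lemma linspan_subspace K : submod_closed [in linspan K].
Proof.
have [spanD spanZ] := posi_closed (K `|` set_opp K `|` [set 0]).
have span0 : linspan K 0 by apply: sub_posi; right.
have spanN f : linspan K f -> linspan K (- f).
  move=> [n [c [g [c_gt0 Kg ->]]]].
  exists n, c, (fun i => - g i); split=> // [i|].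
    case: (Kg i) => [[Ki|/set_oppE Ki]|->]; last by right; rewrite oppr0.
      by left; right; apply/set_oppE; rewrite opprK.
    by left; left.
  by rewrite -sumrN; apply: eq_bigr => i _; rewrite scalerN.
split=> [|a f g /set_mem Kf /set_mem Kg]; apply: mem_set => //.
(* A positive hull only allows positive coefficients, hence the three cases. *)
apply: (spanD) => //; case: (ltrgtP a 0) => [a_lt0|a_gt0|->].
- by rewrite -[a]opprK scaleNr; apply/spanN/spanZ; rewrite ?oppr_gt0.
- exact: spanZ.
- by rewrite scale0r.
Qed.

(** * The model accepting a subspace and the translates of a cone by it *)

(** The elements of the subspace [N] are indifferent, and those of [N + P] are
    favourable; in [set_add N P] the summand from [P] is never dropped, so
    that [N] is added separately to the accepted set. *)
Definition quotient_model N P : assessment V :=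
  Assessment (N `|` set_add N P) (set_add N (set_opp P)).

Lemma asub_anti (A B : assessment V) : asub A B -> asub B A -> A = B.
Proof.
by case: A B => [a r] [a' r'] [/= ? ?] [/= ? ?]; congr Assessment; apply/seteqP.
Qed.

Lemma quotient_model_min L N P M :
    model_without_confusion L M ->
    asub (aunion (Assessment N set0) (Assessment P (set_opp P))) M ->
  submod_closed [in N] -> asub (quotient_model N P) M.
Proof.
move=> [_ _ /coneP[accD _] rejM] [/= saccM srejM] subN.
have NM f : N f -> acc M f by move=> Nf; apply: saccM; left.
split=> [f [/NM//|[h Nh [p Pp <-]]]|_ [h Nh [n Pn <-]]] /=.
  by apply: accD; [exact: NM|apply: saccM; right].
apply: rejM; right; exists n.
  by exists 1; [exact: ltr01|exists n; [apply: srejM; right|rewrite scale1r]].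
exists (- h); last by rewrite opprK addrC.
by apply: NM; exact: subspaceN.
Qed.

Section QuotientModel.
Variables L N P : set V.
Hypotheses (subL : submod_closed [in L]) (subN : submod_closed [in N]).
Hypotheses (sNL : N `<=` L) (sPL : P `<=` L) (clP : cone_closed P).

Local Notation extends M :=
  (asub (aunion (Assessment N set0) (Assessment P (set_opp P))) M).

Lemma quotient_model_extends : extends (quotient_model N P).
Proof.
have N0 := subspace0 subN.
split=> f /= [] //; first by left.
  by move=> Pf; right; exists 0 => //; exists f; rewrite ?add0r.
by move=> Pf; exists 0 => //; exists f; rewrite ?add0r.
Qed.

Lemma quotient_model_without_confusion :
  N `&` set_opp P = set0 -> model_without_confusion L (quotient_model N P).
Proof.
have [PD PZ] := clP => NP0.
have noNP f : N f -> P (- f) -> False.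
  by move=> Nf Pf; rewrite -[False]/(set0 f) -NP0; split=> //; apply/set_oppE.
have ND := subspaceD subN; have NZ := subspaceZ subN.
have NB := subspaceB subN.
split.
- split=> [f [/sNL//|[h /sNL Lh [p /sPL Lp <-]]]|
           _ [h /sNL Lh [n /set_oppE/sPL Ln <-]]].
    exact: subspaceD.
  by apply: subspaceD => //; rewrite -[n]opprK; exact: subspaceN.
- apply/seteqP; split=> // f [/= accf [h Nh [n /set_oppE Pn hnf]]].
  case: accf => [Nf|[h' Nh' [p Pp hpf]]].
    apply: (noNP n) => //.
    by have -> : n = f - h by [rewrite -hnf addrC addKr]; exact: NB.
  apply: (noNP (h' - h)); first exact: NB.
  have -> : - (h' - h) = p - n; last exact: PD.
  rewrite opprB; apply/eqP.
  by rewrite subr_eq addrAC eq_sym subr_eq addrC hpf hnf.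
- apply/coneP; split=> [f g|l f l_gt0] /=.
    move=> [Nf|[h Nh [p Pp <-]]] [Ng|[h' Nh' [p' Pp' <-]]].
    + by left; exact: ND.
    + right; exists (f + h'); first exact: ND.
      by exists p'; rewrite ?addrA.
    + right; exists (h + g); first exact: ND.
      by exists p; rewrite // addrAC.
    + right; exists (h + h'); first exact: ND.
      by exists (p + p'); [exact: PD|rewrite addrACA].
  move=> [Nf|[h Nh [p Pp <-]]]; first by left; exact: NZ.
  right; exists (l *: h); first exact: NZ.
  by exists (l *: p); [exact: PZ|rewrite scalerDr].
- have scale_rej : scaling (set_add N (set_opp P)) `<=` set_add N (set_opp P).
    move=> _ [l l_gt0 [_ [h Nh [n /set_oppE Pn <-]] <-]].
    exists (l *: h); first exact: NZ.
    exists (l *: n); last by rewrite scalerDr.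
    by apply/set_oppE; rewrite -scalerN; exact: PZ.
  move=> f [/scale_rej//|[_ /scale_rej [h Nh [n /set_oppE Pn <-]]]] [g accg <-].
  case: accg => [Ng|[h' Nh' [p Pp <-]]].
    by exists (h - g); [exact: NB|exists n; [exact/set_oppE|rewrite addrAC]].
  exists (h - h'); first exact: NB.
  exists (n - p); last by rewrite opprD addrACA.
  by apply/set_oppE; rewrite opprB addrC; exact: PD.
Qed.

Lemma quotient_model_favour_indifference :
  favour_indifference (quotient_model N P).
Proof.
have NN := subspaceN subN.
split=> [f /set_oppE[h Nh [n /set_oppE Pn hnf]]|].
  right; exists (- h); first exact: NN.
  by exists (- n) => //; rewrite -opprD hnf opprK.
apply/seteqP; split=> [f [Nf|NPf]|f [[]|[]]//].
  by right; split; [left|apply/set_oppE; left; exact: NN].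
left; split; first by right.
case: NPf => h Nh [p Pp <-]; apply/set_oppE; exists (- h); first exact: NN.
by exists (- p); [apply/set_oppE; rewrite opprK|rewrite -opprD].
Qed.

(** An element of both [N] and [- P] is accepted and rejected by every extension
    of the two assessments, so that an extension without confusion excludes
    it. *)
Lemma extends_confusion M :
  acc M `&` rej M = set0 -> extends M -> N `&` set_opp P = set0.
Proof.
move=> M0 [sacc srej]; apply/seteqP; split=> // f [Nf Pf].
by rewrite -M0; split; [apply: sacc; left|apply: srej; right].
Qed.

Lemma quotient_model_fiP :
  [/\ model_without_confusion L (quotient_model N P),
      favour_indifference (quotient_model N P)
    & indifferent_to_status_quo (quotient_model N P)]
  <-> N `&` set_opp P = set0.
Proof.
split=> [[[_ M0 _ _] _ _]|NP0].
  exact: extends_confusion M0 quotient_model_extends.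
split; first exact: quotient_model_without_confusion.
  exact: quotient_model_favour_indifference.
by left; exact: subspace0.
Qed.

Local Notation union :=
  (reckoning_union L (Assessment N set0) (Assessment P (set_opp P))).

Lemma reckoning_union_extends : extends union.
Proof.
split=> f /=.
  move=> NPf; split; first by case: NPf => [/sNL|/sPL].
  by move=> M [_ [sacc _]]; apply: sacc.
move=> [//|Pf]; split; last by move=> M [_ [_ srej]]; apply: srej; right.
by move/set_oppE/sPL/(subspaceN subL): Pf; rewrite opprK.
Qed.

Lemma reckoning_unionE : N `&` set_opp P = set0 -> union = quotient_model N P.
Proof.
move=> NP0; have modelNP := quotient_model_without_confusion NP0.
have [[saccL srejL] _ _ _] := modelNP.
apply: asub_anti.
  by split=> f [_]; apply; split=> //; exact: quotient_model_extends.
split=> f Mf; split; [exact: saccL| |exact: srejL|];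
  by move=> M [modelM extM];
     have [sacc srej] := quotient_model_min modelM extM subN; auto.
Qed.

Lemma reckoning_union_fiP :
  [/\ model_without_confusion L union, favour_indifference union
    & indifferent_to_status_quo union]
  <-> N `&` set_opp P = set0.
Proof.
split=> [[[_ M0 _ _] _ _]|NP0].
  exact: extends_confusion M0 reckoning_union_extends.
by rewrite reckoning_unionE //; apply/quotient_model_fiP.
Qed.

End QuotientModel.

End VectorSpaces.

(** * The order on gambles *)

Section Gambles.
Set Implicit Arguments.
Unset Strict Implicit.
Unset Printing Implicit Defensive.
Variables (R : realType) (Omega : Type).
Implicit Types (f g : gamble R Omega) (L : set (gamble R Omega)).

Lemma ggeP f g : gge f g <-> forall w, (g w : R) <= f w.
Proof.
split=> [fg w|fg].
  rewrite -subr_ge0 -lee_fin; apply: (le_trans fg).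
  by apply: ereal_inf_lbound; exists w.
by apply: le_ereal_inf_tmp => _ [w _ <-]; rewrite lee_fin subr_ge0.
Qed.

Lemma ggt0D f g : ggt f 0 -> ggt g 0 -> ggt (f + g) 0.
Proof.
move=> [/ggeP f_ge0 f_neq0] [/ggeP g_ge0 _]; split.
  by apply/ggeP => w; exact: (addr_ge0 (f_ge0 w) (g_ge0 w)).
move=> fg0; apply: f_neq0; apply/funext => w.
apply/eqP; rewrite eq_le f_ge0 andbT.
have : (f w : R) + g w = 0 by rewrite -[RHS]/((0 : gamble R Omega) w) -fg0.
move=> /eqP; rewrite addr_eq0 => /eqP ->.
by rewrite oppr_le0; exact: g_ge0.
Qed.

Lemma ggt0Z (l : R) f : 0 < l -> ggt f 0 -> ggt (l *: f) 0.
Proof.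
move=> l_gt0 [/ggeP f_ge0 f_neq0]; split.
  by apply/ggeP => w; apply: mulr_ge0; [exact: ltW|exact: f_ge0].
by move=> /eqP; rewrite scaler_eq0 gt_eqF //= => /eqP.
Qed.

Lemma glt0N f : glt f 0 <-> ggt (- f) 0.
Proof.
split=> -[/ggeP f0 f_neq0]; split.
- by apply/ggeP => w; rewrite -[leRHS]/(- (f w : R)) oppr_ge0; exact: f0.
- by move=> /eqP; rewrite oppr_eq0 => /eqP /esym.
- by apply/ggeP => w; rewrite -oppr_ge0; exact: f0.
- by move=> f_eq0; apply: f_neq0; rewrite -f_eq0 oppr0.
Qed.

Lemma gpos_closed L : linear_subspace L -> cone_closed (gpos L).
Proof.
move=> subL; split=> [f g [Lf f_gt0] [Lg g_gt0]|l f l_gt0 [Lf f_gt0]].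
  by split; [exact: subspaceD|exact: ggt0D].
by split; [exact: subspaceZ|exact: ggt0Z].
Qed.

Lemma gnegE L : linear_subspace L -> gneg L = set_opp (gpos L).
Proof.
move=> subL; apply/seteqP; split=> f.
  move=> [Lf /glt0N f_lt0]; apply/set_oppE; split=> //; exact: subspaceN.
move=> /set_oppE[/(subspaceN subL) + /glt0N]; rewrite opprK; by split.
Qed.

End Gambles.

Theorem proposition6p1 (R : realType) (Omega : Type)
    (Omega_nonempty : [set: Omega] !=set0)
    (L : set (gamble R Omega)) (L_subspace : linear_subspace L)
    (TT : set (Omega -> Omega)) (TT_monoid : transformation_monoid TT) :
  let LT := background_indifferent L TT in
  let no_negative := ~ exists2 f : gamble R Omega, LT f & glt f 0 in
  [/\ status_quo_fi_model L (status_quo_model L TT) <-> no_negative,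
      status_quo_fi_model L (status_quo_model_explicit L TT) <-> no_negative
    & no_negative ->
      status_quo_model L TT = status_quo_model_explicit L TT].
Proof.
move=> LT no_negative.
have subLT : submod_closed [in LT] by exact: linspan_subspace.
have sLTL : LT `<=` L by apply: linspan_sub => // f [].
have sposL : gpos L `<=` L by move=> f [].
have clpos := gpos_closed L_subspace.
have negE := gnegE L_subspace.
have no_negP : no_negative <-> LT `&` set_opp (gpos L) = set0.
  rewrite -negE; split=> [noneg|LT0 [f LTf f_lt0]].
    by apply/seteqP; split=> // f [LTf [_ f_lt0]]; apply: noneg; exists f.
  by rewrite -[False]/(set0 f) -LT0; split=> //; split=> //; exact: sLTL.
rewrite /status_quo_fi_model /status_quo_model /status_quo_model_explicit.
rewrite negE -/LT -/(quotient_model LT (gpos L)).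
split; [|exact: iff_trans (quotient_model_fiP _ _ _ _ _) (iff_sym _)|].
- exact: iff_trans (reckoning_union_fiP _ _ _ _ _) (iff_sym _).
- by move=> /no_negP; exact: reckoning_unionE.
Qed.
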